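(* Let $P$ be a finite poset with $n$ elements and let $I\subseteq[n-1]$. Then the coefficient $[F_I]L_P$ of $F_I$ in the expansion of $L_P$ in the basis of fundamental quasisymmetric functions is $$[F_I]L_P=\sum_{\omega\in\Sigma_P(I)}\chi_{\mathrm{Comp}(P,\omega)}(I).$$
   Context: For a composition $\alpha=(\alpha_1,\dots,\alpha_k)\models n$ put $\mathrm{set}(\alpha)=\{\alpha_1,\alpha_1+\alpha_2,\dots,\alpha_1+\cdots+\alpha_{k-1}\}\subseteq[n-1]$; this is a bijection between compositions of $n$ and subsets of $[n-1]$. $M_\alpha=\sum_{i_1<\cdots<i_k}x_{i_1}^{\alpha_1}\cdots x_{i_k}^{\alpha_k}$, and $F_I=\sum x_{i_1}\cdots x_{i_n}$, summed over $1\le i_1\le\cdots\le i_n$ with $i_j<i_{j+1}$ for each $j\in I$. For a finite poset $P$ with $n$ elements, $\Sigma_P$ is the set of $P$-listings (lists $\omega=(\omega_1,\dots,\omega_n)$ of all elements of $P$ without repetition). A linear extension is a listing with no $i<j$ such that $\omega_j\le_P\omega_i$; $\zeta(P)$ is the number of linear extensions of $P$. A composition $\alpha$ is compatible with $\omega\in\Sigma_P$ if the consecutive segments $(\omega_1,\dots,\omega_{\alpha_1}),\dots,(\omega_{\alpha_1+\cdots+\alpha_{k-1}+1},\dots,\omega_n)$ are linear extensions of the induced subposets on their elements. $\mathrm{Comp}(P,\omega)$ denotes the collection of all sets $\mathrm{set}(\alpha)\subseteq[n-1]$ for $\alpha$ compatible with $\omega$; for $I\subseteq[n-1]$, $\Sigma_P(I)=\{\omega\in\Sigma_P\mid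 I\in\mathrm{Comp}(P,\omega)\}$. The collection $\mathrm{Comp}(P,\omega)$ is nonempty and closed under taking supersets in $2^{[n-1]}$. For a nonempty collection $\mathcal{A}\subseteq 2^{[n-1]}$ closed under supersets, ordered by inclusion, and $S\in\mathcal{A}$, $\chi_{\mathcal{A}}(S)=\sum_{T}(-1)^{d(T)}$, the sum being over $T\in\mathcal{A}$ with $T\subseteq S$, where $d(T)$ is the length (number of steps) of a longest chain from $T$ to $S$ in $\mathcal{A}$; equivalently $\chi_{\mathcal{A}}(S)=\sum_{T\in\mathcal{A},\,T\subseteq S}(-1)^{|S|-|T|}$. The linear function of $P$ is $L_P=\sum\zeta(P_1)\cdots\zeta(P_k)M_{(|P_1|,\dots,|P_k|)}\in QSym$ (over a field $\mathbf{k}$ of characteristic $0$), the sum being over all set compositions (ordered set partitions into nonempty blocks) $(P_1,\dots,P_k)$ of $P$, each block with the induced order; it is the image of $P$ under the canonical morphism to $QSym$ from the Hopf algebra of posets (product: ordinal sum; coproduct: $P\mapsto\sum_S P|_S\otimes P|_{P\setminus S}$) with character $\zeta$. *)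

(* Defs.v *)
From HB Require Import structures.
From mathcomp Require Import all_boot all_order all_algebra.
From mathcomp Require Import finmap monalg.
From mathcomp Require Import boolp classical_sets fsbigop.

Set Implicit Arguments.
Unset Strict Implicit.
Unset Printing Implicit Defensive.

Import Order.TTheory GRing.Theory Num.Theory.

Local Open Scope ring_scope.

(* Throughout, [i : 'I_n.-1] stands for the element [i.+1] of [n-1].  The     *)
(* degree n has to be carried separately: 'I_0.-1 and 'I_1.-1 are both empty. *)

Definition composition (n : nat) (a : seq nat) : bool :=
  all (leq 1) a && (sumn a == n).

Definition comp_set (n : nat) (a : seq nat) : {set 'I_n.-1} :=
  [set i : 'I_n.-1 |
    [exists j : 'I_(size a), (0 < j)%N && (i.+1 == sumn (take j a))]]%SET.

(* Formal power series in x_0, x_1, ... are functions u |-> coefficient of u; *)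
(* the variable x_i here is x_{i+1} of the usual 1-based numbering.           *)
Definition pseries (K : Type) := {cmonom nat} -> K.

(* x_{i_1}^{a_1} ... x_{i_k}^{a_k} *)
Definition xmon (i a : seq nat) : {cmonom nat} :=
  \big[mmul/mone]_(p <- zip i a) expcmn (ucm p.1) p.2.

(* In QM and QF the sum runs over an infinite index set; it is taken          *)
(* coefficientwise with a finitely supported sum.  For a with positive        *)
(* entries every monomial occurs in only finitely many terms.                 *)
Definition QM (K : fieldType) (a : seq nat) : pseries K := fun u =>
  \sum_(i \in [set i : (size a).-tuple nat | sorted ltn i]%classic)
    ((xmon i a == u)%:R : K).

Definition QF (K : fieldType) (n : nat) (I : {set 'I_n.-1}) : pseries K :=
  fun u =>
  \sum_(i \in [set i : n.-tuple nat |
        sorted leq i /\ forall j, j \in I -> (nth 0 i j < nth 0 i j.+1)%N]%classic)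
    ((xmon i (nseq n 1%N) == u)%:R : K).

(* An expansion in the F basis of QSym (all degrees): a finitely supported    *)
(* family of coefficients indexed by the pairs (n, I), I a subset of [n-1].   *)
Definition Fcoefs (K : fieldType) :=
  {fsfun {n : nat & {set 'I_n.-1}} -> K with 0}.

Definition F_expansion (K : fieldType) (f : pseries K) (c : Fcoefs K) : Prop :=
  forall u, f u = \sum_(b <- finsupp c) c b * QF K (tagged b) u.

Section Poset.
Context {d : Order.disp_t} {P : finPOrderType d}.

Definition lin_ext (w : seq P) : bool :=
  pairwise (fun x y => ~~ (y <= x)%O) w.

Definition listings (n : nat) (S : {set P}) : {set n.-tuple P} :=
  [set w : n.-tuple P | perm_eq w (enum S)]%SET.

Definition zeta (S : {set P}) : nat :=
  #|[set w in listings #|S| S | lin_ext w]%SET|.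

Definition compatible (a : seq nat) (w : seq P) : bool :=
  all lin_ext (reshape a w).

Definition Comp (n : nat) (w : n.-tuple P) : {set {set 'I_n.-1}} :=
  [set I | `[< exists a,
    [/\ composition n a, compatible a w & comp_set n a = I] >]]%SET.

Definition Sigma (n : nat) (I : {set 'I_n.-1}) : {set n.-tuple P} :=
  [set w in listings n [set: P]%SET | I \in Comp w]%SET.

Definition set_composition (s : seq {set P}) : bool :=
  uniq s && finset.partition [set B in s]%SET [set: P]%SET.

End Poset.

(* A set composition has at most #|P| blocks, whence the bounded sequences.   *)
Definition LP (K : fieldType) (d : Order.disp_t) (P : finPOrderType d) :
    pseries K := fun u =>
  \sum_(s : #|P|.-bseq {set P} | set_composition s)
    (\prod_(B <- s) zeta B)%:R * QM K [seq #|pred_of_set B| | B <- s] u.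

Section Chi.
Context {T : finType}.
Implicit Types (A : {set {set T}}) (U S : {set T}).

(* c lists the steps of a chain from U to S in A, without its first element U *)
Definition is_chain A U S (c : seq {set T}) : bool :=
  [&& path (fun X Y : {set T} => X \proper Y) U c, last U c == S & all (mem A) (U :: c)].

(* A chain in A has at most #|A| elements, hence fewer than #|A| steps. *)
Definition chain_length A U S : nat :=
  \max_(k < #|A| | [exists c : k.-tuple {set T}, is_chain A U S c]) k.

Definition chi A S : int :=
  \sum_(U in A | U \subset S) (-1) ^+ chain_length A U S.

End Chi.

(* Main.v *)
Require Import Defs.
From HB Require Import structures.
From mathcomp Require Import boolp classical_sets fsbigop.
From mathcomp Require Import all_boot all_order all_algebra.
From mathcomp Require Import finmap monalg.
From mathcomp Require Import zify.

(* Extract coefficients monomial by monomial.  A monomial u of degree m is the *)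
(* content of a unique weakly increasing word, whose ascent set D is a subset *)
(* of [m-1].  The coefficient of u in F_J is 1 if J is a subset of D and 0    *)
(* otherwise, while its coefficient in L_P is the number of listings w with D *)
(* in Comp(P, w).  Hence c is an F-expansion of L_P iff the sum of c(J) over  *)
(* J included in D is that number for all m and D, which determines c by      *)
(* induction on |D|.  As Comp(P, w) is closed under supersets, longest chains *)
(* are saturated and chi inverts these sums over the Boolean lattice.         *)

Set Implicit Arguments.
Unset Strict Implicit.
Unset Printing Implicit Defensive.

Import Order.TTheory GRing.Theory Num.Theory.

Local Open Scope nat_scope.

(** The formula is a Möbius inversion on a Boolean lattice, carried out listing by listing. A set
    composition with a linear extension of each block is the same thing as a listing cut into
    compatible segments ([sum_set_compositions]), so the coefficient of a monomial in $L_P$ counts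
    the listings compatible with its sequence of exponents ([LPE]). A composition is compatible with
    [w] exactly when its cuts separate every pair $i<j$ with $w_j\le w_i$ ([compatibleP],
    [mem_CompP]); hence compatibility depends only on the set of cuts and is preserved by adding
    cuts ([Comp_upset]).

    On the other side, [QFE] shows that the sums of the $F$-coefficients over all $J\subseteq D$
    must be these counts, and such sums determine the coefficients ([F_expansion_uniq]). For one
    listing, the sums of $\chi$ over the members of [Comp w] inside $D$ give the indicator of $D$
    belonging to it ([sum_chi_upset]); adding over listings ([sum_chi_Comp]) gives the counts. *)

(** * Block indices, cuts and compatibility *)

Lemma reshape_index_cons n a i :
  reshape_index (n :: a) i =
  if i < n then 0 else (reshape_index a (i - n)).+1.
Proof.
rewrite /reshape_index /= subn_eq0; case: ltnP => // le_ni.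
by rewrite subSn.
Qed.

(** A Galois connection between block numbers and partial sums, from which monotonicity and the
    description of cuts follow. *)
Lemma leq_reshape_index a l i : l <= size a ->
  (l <= reshape_index a i) = (sumn (take l a) <= i).
Proof.
elim: a l i => [|n a IHa] [|l] i //= le_la.
rewrite reshape_index_cons; case: (ltnP i n) => [lt_in|le_ni].
  by rewrite ltn0; lia.
by rewrite ltnS IHa // leq_subRL.
Qed.

Lemma reshape_index_homo a i j :
  i <= j -> j < sumn a -> reshape_index a i <= reshape_index a j.
Proof.
move=> le_ij lt_ja.
have lt_ia : i < sumn a by lia.
have r_i := reshape_indexP lt_ia.
rewrite leq_reshape_index; last exact: ltnW.
by apply: leq_trans le_ij; rewrite -leq_reshape_index ?leqnn // ltnW.
Qed.

Lemma mem_comp_set n a (i : 'I_n.-1) : sumn a = n ->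
  (i \in comp_set n a) = (reshape_index a i < reshape_index a i.+1).
Proof.
move=> sum_a; have lt_i1a : i.+1 < sumn a by have := ltn_ord i; lia.
apply/idP/idP => [|lt_r].
  rewrite inE => /existsP[j /andP[j_gt0 /eqP def_i]].
  have le_ja : j <= size a := ltnW (ltn_ord j).
  apply: (@leq_trans j).
    by rewrite ltnNge leq_reshape_index // -def_i -ltnNge.
  by rewrite leq_reshape_index // -def_i.
have lt_ra := reshape_indexP lt_i1a.
(* The witness is the block containing position [i.+1]: since the block index has just jumped, that
   block starts there. *)
rewrite inE; apply/existsP; exists (Ordinal lt_ra) => /=.
apply/andP; split; first exact: leq_ltn_trans lt_r.
rewrite eqn_leq -(leq_reshape_index i.+1) ?leqnn ?andbT; last exact: ltnW.
by move: lt_r; rewrite ltnNge leq_reshape_index -?ltnNge // ltnW.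
Qed.

(** Applied to the block index, this turns two positions lying in different blocks into a cut
    between them. *)
Lemma homo_jumpP (f : nat -> nat) i j :
    (forall k, i <= k < j -> f k <= f k.+1) -> i <= j ->
  (f i < f j) <-> exists2 k, i <= k < j & f k < f k.+1.
Proof.
move=> f_homo le_ij; rewrite -(subnK le_ij) in f_homo *.
move: (j - i) f_homo => m.
have homo m' : (forall k, i <= k < m' + i -> f k <= f k.+1) ->
    f i <= f (m' + i).
  elim: m' => // m' IHm fH; apply: leq_trans (IHm _) (fH _ _); last by lia.
  by move=> k lt_k; apply: fH; lia.
elim: m => [|m IHm] fH.
  by rewrite add0n; split=> [|[k]]; lia.
have fH' k : i <= k < m + i -> f k <= f k.+1 by move=> lt_k; apply: fH; lia.
have f_last : f (m + i) <= f (m + i).+1 by apply: fH; lia.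
rewrite addSn; split=> [lt_f|[k lt_k lt_fk]].
  have [lt_fm|le_fm] := ltnP (f (m + i)) (f (m + i).+1).
    by exists (m + i) => //; lia.
  have [|k lt_k lt_fk] := (IHm fH').1; first by lia.
  by exists k => //; lia.
have := homo m fH'; have := (IHm fH').2.
have [def_k|ne_k] := eqVneq k (m + i); first by rewrite def_k in lt_fk *; lia.
have lt_k' : i <= k < m + i by move: lt_k ne_k; rewrite ltnS leq_eqVlt; lia.
by move=> /(_ (ex_intro2 _ _ k lt_k' lt_fk)); lia.
Qed.

Lemma all_pairwiseP (T : Type) (e : rel T) x0 (ss : seq (seq T)) :
  (forall i j, i < j < size (flatten ss) ->
    reshape_index (shape ss) i = reshape_index (shape ss) j ->
    e (nth x0 (flatten ss) i) (nth x0 (flatten ss) j)) <->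
  all (pairwise e) ss.
Proof.
rewrite size_flatten; set sh := shape ss.
have nth_sh l : nth 0 sh l = size (nth [::] ss l).
  have [lt_l|le_l] := ltnP l (size ss); first by rewrite (nth_map [::]).
  by rewrite !nth_default // size_map.
split=> [ss_e|/all_nthP ss_e i j /andP[lt_ij lt_j] eq_r].
  apply/(all_nthP [::]) => l lt_l; apply/(pairwiseP x0) => p q.
  rewrite !inE => lt_p lt_q lt_pq.
  have lt_p' : p < nth 0 sh l by rewrite nth_sh.
  have lt_q' : q < nth 0 sh l by rewrite nth_sh.
  have := ss_e (flatten_index sh l p) (flatten_index sh l q).
  rewrite ltn_add2l lt_pq flatten_indexP // !nth_flatten -/sh.
  by rewrite !flatten_indexKl // !flatten_indexKr //; apply.
have lt_i := ltn_trans lt_ij lt_j.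
rewrite !nth_flatten -/sh -eq_r.
have lt_r : reshape_index sh i < size ss.
  by rewrite -(size_map size ss) reshape_indexP.
have /(pairwiseP x0) := ss_e [::] _ lt_r; apply; rewrite ?inE -?nth_sh.
- exact: reshape_offsetP.
- by rewrite eq_r reshape_offsetP.
rewrite -[i in i < _](reshape_indexK sh) -[j in _ < j](reshape_indexK sh) in lt_ij.
by rewrite -eq_r ltn_add2l in lt_ij.
Qed.

Section Compatible.
Context {d : Order.disp_t} {P : finPOrderType d} (n : nat).
Implicit Types (w : n.-tuple P) (I : {set 'I_n.-1}).

(** A segment fails to be a linear extension only through a bad pair inside it, and two positions
    lie in different segments iff some cut falls between them. *)
Lemma compatibleP w a : composition n a ->
  reflect (forall i j : 'I_n, i < j -> (tnth w j <= tnth w i)%O ->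
             exists2 k : 'I_n.-1, k \in comp_set n a & i <= k < j)
          (compatible a w).
Proof.
case/andP=> a_gt0 /eqP sum_a; pose r := reshape_index a.
have r_lt (i j : nat) : i < j < n -> (r i < r j) <->
    exists2 k : 'I_n.-1, k \in comp_set n a & i <= k < j.
  move=> /andP[lt_ij lt_j].
  have r_homo k : i <= k < j -> r k <= r k.+1.
    by move=> lt_k; apply: reshape_index_homo; lia.
  split=> [/(homo_jumpP r_homo (ltnW lt_ij))|] [k].
    move=> lt_k lt_r; have lt_kn : k < n.-1 by lia.
    by exists (Ordinal lt_kn) => //; rewrite mem_comp_set.
  rewrite mem_comp_set // => lt_r lt_k.
  by apply/(homo_jumpP r_homo (ltnW lt_ij)); exists k.
have flat_w : flatten (reshape a w) = w.
  by rewrite reshapeKr // size_tuple sum_a.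
have shape_w : shape (reshape a w) = a.
  by rewrite reshapeKl // size_tuple sum_a.
(* Degree 0 is separate because [P] may be empty and then offers no default letter; the only
   composition of 0 is the empty one. *)
have [n0|n_gt0] := posnP n.
  rewrite (_ : compatible a w); last first.
    case: a a_gt0 sum_a {r r_lt flat_w shape_w} => //= b a /andP[b_gt0 _].
    by lia.
  by constructor=> i; have := ltn_ord i; rewrite {2}n0.
have x0 := tnth w (Ordinal n_gt0).
apply: (iffP idP) => [/(all_pairwiseP _ x0)|br].
  rewrite flat_w shape_w size_tuple => lin i j lt_ij le_w.
  apply/r_lt; first by rewrite lt_ij ltn_ord.
  rewrite ltn_neqAle reshape_index_homo ?sum_a ?(ltnW lt_ij) ?ltn_ord // andbT.
  apply: contraL le_w => /eqP eq_r.
  by rewrite !(tnth_nth x0) lin // lt_ij ltn_ord.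
apply/(all_pairwiseP _ x0); rewrite flat_w shape_w size_tuple.
move=> i j /andP[lt_ij lt_j] eq_r; apply/negP => le_w.
have lt_i := ltn_trans lt_ij lt_j.
have := br (Ordinal lt_i) (Ordinal lt_j) lt_ij.
rewrite !(tnth_nth x0) => /(_ le_w)/r_lt.
by rewrite lt_ij lt_j /r eq_r ltnn => /(_ isT).
Qed.
End Compatible.

(** * Monomials as weakly increasing words *)

Definition letters (u : {cmonom nat}) : seq nat :=
  sort leq (flatten [seq nseq (u j) j | j <- finsupp u]).

Definition spread (i a : seq nat) : seq nat :=
  flatten [seq nseq p.2 p.1 | p <- zip i a].

(** On a weakly increasing word these are the run lengths, read from left to right. *)
Definition runs (s : seq nat) : seq nat :=
  [seq count_mem x s | x <- undup s].

Definition ascents n (s : seq nat) : {set 'I_n.-1} :=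
  [set k : 'I_n.-1 | nth 0 s k < nth 0 s k.+1].

Lemma letters_sorted u : sorted leq (letters u).
Proof. exact: sort_sorted leq_total _. Qed.

Lemma count_letters u j : count_mem j (letters u) = u j.
Proof.
rewrite count_sort count_flatten -map_comp.
rewrite (eq_map (g := fun k => (k == j) * u k)); last first.
  by move=> k /=; rewrite count_nseq.
have [u_j|/fsfun_dflt u_j0] := boolP (j \in finsupp u); last first.
  rewrite u_j0 sumnE big_map big1_seq // => k /=.
  by have [->|] := eqVneq k j; rewrite ?u_j0.
rewrite sumnE big_map (bigD1_seq j) ?fset_uniq //= eqxx mul1n big1 ?addn0 // => k /negPf->.
by [].
Qed.

Lemma count_spread i a j :
  count_mem j (spread i a) = \sum_(p <- zip i a) (p.1 == j) * p.2.
Proof.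
rewrite /spread count_flatten -map_comp sumnE big_map.
by apply: eq_bigr => p _; rewrite /= count_nseq.
Qed.

Lemma xmonE i a j : xmon i a j = count_mem j (spread i a).
Proof.
have expE (m : {cmonom nat}) k : expcmn m k j = k * m j.
  case: k => [|k]; first by rewrite cm1.
  rewrite /expcmn /iterop iteriS.
  elim: k => [|k IHk] /=; first by rewrite mul1n.
  by rewrite cmM IHk -mulSn.
rewrite count_spread /xmon; elim/big_rec2: _ => [|p c m _ <-].
  by rewrite cm1.
by rewrite cmM expE cmU mulnC.
Qed.

(** Commutative monomials agree iff their multisets of letters do. *)
Lemma xmon_eqE i a u : (xmon i a == u) = perm_eq (spread i a) (letters u).
Proof.
apply/cmP/idP => [eq_c|/permP eq_c j]; last first.
  by rewrite xmonE eq_c count_letters.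
by apply/allP => j _ /=; rewrite count_letters -eq_c xmonE.
Qed.

Lemma spread_subset i a : {subset spread i a <= i}.
Proof.
rewrite /spread; elim: i a => [|x i IHi] [|m a] //= y.
by rewrite mem_cat inE => /orP[/nseqP[-> _]|/IHi->]; rewrite ?eqxx ?orbT.
Qed.

Lemma spread_sorted i a : sorted ltn i -> sorted leq (spread i a).
Proof.
rewrite /spread (sorted_pairwise ltn_trans) (sorted_pairwise leq_trans).
elim: i a => [|x i IHi] [|m a] //= /andP[/allP x_min /IHi {}IHi].
rewrite pairwise_cat IHi andbT; apply/andP; split; last first.
  by apply/(pairwiseP 0) => p q; rewrite !inE size_nseq => ??; rewrite !nth_nseq !ifT.
by apply/allrelP => y z /nseqP[-> _] /spread_subset /x_min /ltnW.
Qed.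

Lemma spread1 i : spread i (nseq (size i) 1) = i.
Proof. by elim: i => //= x i IHi; congr cons. Qed.

Lemma spread_runs s : sorted leq s -> spread (undup s) (runs s) = s.
Proof.
move=> s_sorted; apply: (sorted_eq leq_trans anti_leq) => //.
  apply: spread_sorted; rewrite ltn_sorted_uniq_leq undup_uniq /=.
  exact: (subseq_sorted leq_trans (undup_subseq _)) s_sorted.
have -> : spread (undup s) (runs s) =
    flatten [seq nseq (count_mem x s) x | x <- undup s].
  rewrite /spread /runs; congr flatten.
  by elim: (undup s) => //= x t ->.
exact: perm_count_undup.
Qed.

Lemma mem_spread i a : all (leq 1) a -> size i = size a -> spread i a =i i.
Proof.
rewrite /spread; elim: i a => [|x i IHi] [|m a] //= /andP[m_gt0 a_gt0] [sz_i] y.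
by rewrite mem_cat mem_nseq m_gt0 inE IHi.
Qed.

Lemma undup_spread i a : sorted ltn i -> all (leq 1) a -> size i = size a ->
  undup (spread i a) = i.
Proof.
move=> i_sorted a_gt0 sz_i.
apply: (irr_sorted_eq ltn_trans ltnn) => // [|x].
  rewrite ltn_sorted_uniq_leq undup_uniq /=.
  exact: (subseq_sorted leq_trans (undup_subseq _)) (spread_sorted a i_sorted).
by rewrite mem_undup mem_spread.
Qed.

Lemma runs_spread i a : sorted ltn i -> all (leq 1) a -> size i = size a ->
  runs (spread i a) = a.
Proof.
move=> i_sorted a_gt0 sz_i; rewrite /runs undup_spread //.
have i_uniq : uniq i by apply: sorted_uniq i_sorted; [exact: ltn_trans|exact: ltnn].
apply: (eq_from_nth (x0 := 0)) => [|l]; rewrite size_map // => lt_l.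
(* The entries of [i] are distinct, so only the pair at position [l] contributes to this count. *)
rewrite (nth_map 0) // count_spread (bigD1_seq (nth 0 i l, nth 0 a l)) /=.
- rewrite eqxx mul1n big1_seq ?addn0 // => -[x m] /= /andP[+ /(nthP (0, 0))[p]].
  rewrite size_zip sz_i minnn => ne_xm lt_p; rewrite nth_zip // => -[def_x def_m].
  have [eq_x|//] := eqVneq x (nth 0 i l); rewrite -def_x in eq_x.
  move/eqP: eq_x; rewrite nth_uniq ?sz_i -?sz_i // ?sz_i // => /eqP eq_p.
  by rewrite -def_x -def_m eq_p eqxx in ne_xm.
- by rewrite -nth_zip // mem_nth // size_zip sz_i minnn -sz_i.
have : uniq (unzip1 (zip i a)) by rewrite unzip1_zip ?sz_i.
exact: map_uniq.
Qed.

Lemma runs_composition s : composition (size s) (runs s).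
Proof.
apply/andP; split.
  by apply/allP => _ /mapP[x x_s ->] /=; rewrite -has_count has_pred1 -mem_undup.
rewrite -(perm_size (perm_count_undup s)) size_flatten /shape -map_comp.
by apply/eqP; congr sumn; apply: eq_map => x /=; rewrite size_nseq.
Qed.

Lemma nth_spread i a p : size i = size a -> p < sumn a ->
  nth 0 (spread i a) p = nth 0 i (reshape_index a p).
Proof.
move=> sz_i lt_p; rewrite /spread nth_flatten.
have -> : shape [seq nseq q.2 q.1 | q <- zip i a] = a.
  rewrite /shape -map_comp (eq_map (g := snd)) => [|q]; last by rewrite /= size_nseq.
  by rewrite -/unzip2 unzip2_zip ?sz_i.
have lt_r := reshape_indexP lt_p.
rewrite (nth_map (0, 0)) ?size_zip ?sz_i ?minnn // nth_zip //= nth_nseq.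
by rewrite reshape_offsetP.
Qed.

(** In a weakly increasing word a new run begins exactly at a strict ascent. This links the
    exponents, which govern $M$, to the ascents, which govern $F$. *)
Lemma comp_set_runs n s : sorted leq s -> size s = n ->
  comp_set n (runs s) = ascents n s.
Proof.
move=> s_sorted sz_s; apply/setP => k.
have /andP[_ /eqP sum_runs] := runs_composition s; rewrite sz_s in sum_runs.
rewrite mem_comp_set // inE -{3 4}(spread_runs s_sorted).
have lt_k1 : k.+1 < sumn (runs s) by rewrite sum_runs; have := ltn_ord k; lia.
have lt_k : k < sumn (runs s) by exact: ltnW.
have sz_runs : size (undup s) = size (runs s) by rewrite size_map.
rewrite !nth_spread //.
have := reshape_index_homo (leqnSn k) lt_k1.
rewrite leq_eqVlt => /predU1P[->|lt_r]; first by rewrite !ltnn.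
rewrite lt_r; apply/esym/(sorted_ltn_nth ltn_trans); rewrite ?inE ?sz_runs ?reshape_indexP //.
rewrite ltn_sorted_uniq_leq undup_uniq /=.
exact: (subseq_sorted leq_trans (undup_subseq _)) s_sorted.
Qed.

Lemma letters_xmon s : sorted leq s -> letters (xmon s (nseq (size s) 1)) = s.
Proof.
move=> s_sorted; apply: (sorted_eq leq_trans anti_leq) => //.
  exact: letters_sorted.
by rewrite perm_sym -{1}(spread1 s) -xmon_eqE.
Qed.

(** The word whose letter at position $p$ is the number of elements of $J$ below $p$ climbs exactly
    at $J$. It shows both that every set is a [comp_set] and that every $D$ is tested by some
    monomial. *)
Lemma exists_ascents n (J : {set 'I_n.-1}) :
  exists2 u : {cmonom nat}, size (letters u) = n & ascents n (letters u) = J.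
Proof.
pose f p := #|[set k in J | k < p]|.
pose s := mkseq f n.
have f_homo p q : p <= q -> f p <= f q.
  move=> le_pq; apply: subset_leq_card; apply/subsetP => k.
  by rewrite !inE => /andP[-> lt_k]; apply: leq_trans le_pq.
have s_sorted : sorted leq s.
  apply: (homo_sorted (e := leq)) => //; exact: iota_sorted.
exists (xmon s (nseq (size s) 1)); rewrite letters_xmon ?size_mkseq //.
apply/setP => k; have := ltn_ord k => lt_k.
rewrite inE !nth_mkseq; try lia.
rewrite /f; have [k_J|k_J] := boolP (k \in J).
  apply: proper_card; apply/properP; split; last first.
    by exists k; rewrite !inE k_J ?ltnSn ?ltnn.
  by apply/subsetP => l; rewrite !inE => /andP[-> /ltnW].
apply/negbTE; rewrite -leqNgt; apply: subset_leq_card.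
apply/subsetP => l; rewrite !inE ltnS leq_eqVlt => /andP[l_J].
rewrite l_J => /predU1P[/val_inj eq_l|//].
by rewrite -eq_l l_J in k_J.
Qed.

(** * The collection of compatible sets is an up-set *)

Section CompUpset.
Context {d : Order.disp_t} {P : finPOrderType d} (n : nat).
Implicit Types (w : n.-tuple P) (I J : {set 'I_n.-1}).

(** The existential over compositions disappears because [I] is always the set of some composition,
    namely the run lengths of a word with ascent set [I]. *)
Lemma mem_CompP w I :
  reflect (forall i j : 'I_n, i < j -> (tnth w j <= tnth w i)%O ->
             exists2 k : 'I_n.-1, k \in I & i <= k < j)
          (I \in Comp w).
Proof.
rewrite inE; apply: (iffP (asboolP _)) => [[a [a_comp w_comp <-]]|br].
  exact/compatibleP.
have [u sz_u asc_u] := exists_ascents I.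
have a_comp := runs_composition (letters u); rewrite sz_u in a_comp.
have def_I : comp_set n (runs (letters u)) = I.
  by rewrite comp_set_runs ?letters_sorted.
exists (runs (letters u)); split=> //.
by apply/(compatibleP _ a_comp); rewrite def_I.
Qed.

Lemma Comp_upset w I J : I \in Comp w -> I \subset J -> J \in Comp w.
Proof.
move=> /mem_CompP br /subsetP sIJ; apply/mem_CompP => i j lt_ij le_w.
by have [k /sIJ k_J lt_k] := br i j lt_ij le_w; exists k.
Qed.

Lemma mem_Comp_comp_set w a : composition n a ->
  (comp_set n a \in Comp w) = compatible a w.
Proof. by move=> a_comp; apply/mem_CompP/(compatibleP _ a_comp). Qed.

End CompUpset.

(** * Longest chains in an up-set *)

Section ChiUpset.
Context {T : finType}.
Implicit Types (A : {set {set T}}) (U S D : {set T}) (c : seq {set T}).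
Local Notation ltS := (fun X Y : {set T} => X \proper Y).

Lemma path_proper_card U c : path ltS U c -> #|U| + size c <= #|last U c|.
Proof.
elim: c U => [|X c IHc] U /=; first by rewrite addn0.
by case/andP=> /proper_card ltUX /IHc; lia.
Qed.

Lemma exists_saturated_chain U S : U \subset S ->
  exists c, [/\ path ltS U c, last U c = S & size c = #|S| - #|U|].
Proof.
move: {2}(_ - _) (erefl (#|S| - #|U|)) => m.
elim: m U => [|m IHm] U sz_U sUS.
  have /eqP eqUS : U == S by rewrite eqEcard sUS -subn_eq0 sz_U.
  by exists [::]; split; rewrite ?sz_U.
have /properP[_ [x x_S x_U]] : U \proper S by rewrite properEcard sUS -subn_gt0 sz_U.
have sz_xU : #|S| - #|x |: U| = m by rewrite cardsU1 x_U; lia.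
have sxUS : x |: U \subset S by rewrite subUset sub1set x_S.
have [c [path_c last_c sz_c]] := IHm _ sz_xU sxUS.
exists (x |: U :: c); split=> //=; last by rewrite sz_c; lia.
by rewrite path_c andbT properUr // sub1set.
Qed.

(** Each step of a chain gains at least one element, which bounds the length. A chain adding one
    element at a time attains the bound, and it stays in [A] because all its members contain [U]. *)
Lemma chain_length_upset A U S :
    (forall X Y : {set T}, X \in A -> X \subset Y -> Y \in A) -> U \in A -> U \subset S ->
  chain_length A U S = #|S| - #|U|.
Proof.
move=> A_up U_A sUS; apply/eqP; rewrite eqn_leq; apply/andP; split.
  apply/bigmax_leqP => k /existsP[c /and3P[/path_proper_card + /eqP last_c _]].
  by rewrite last_c size_tuple; lia.
have [c [path_c last_c sz_c]] := exists_saturated_chain sUS.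
have ltS_trans : transitive ltS by move=> X Y Z; exact: proper_trans.
have c_A : {subset U :: c <= A}.
  have := order_path_min ltS_trans path_c => /allP c_gtU X.
  by rewrite inE => /predU1P[-> //|/c_gtU /proper_sub]; apply: A_up.
have c_uniq : uniq (U :: c).
  by apply: (sorted_uniq ltS_trans) => // X; apply: properxx.
(* The maximum in [chain_length] ranges over [k < #|A|]; the chain fits since its members, [U]
   included, are distinct elements of [A]. *)
have lt_c : size c < #|A|.
  by rewrite cardE; apply: (uniq_leq_size c_uniq) => X /c_A; rewrite mem_enum.
rewrite -sz_c; apply: (@leq_bigmax_cond _ _ _ (Ordinal lt_c)).
apply/existsP; exists (in_tuple c); apply/and3P; split=> //; first exact/eqP.
exact/allP.
Qed.

End ChiUpset.

(** * Set compositions and compatible listings *)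

Section Arrangements.
Context {d : Order.disp_t} {P : finPOrderType d}.
Implicit Types (B : {set P}) (s : seq {set P}) (w : seq P).

Definition cards s : seq nat := [seq #|pred_of_set B| | B <- s].

Definition blocks (a : seq nat) w : seq {set P} :=
  [seq [set x in b] | b <- reshape a w].

Definition lin_exts B : seq (seq P) :=
  [seq tval x | x <- enum [set x in listings #|B| B | lin_ext x]].

(** The words counted by the product of the [zeta B] in [LP]. *)
Definition arrangements s : seq (seq P) :=
  foldr (fun B L => [seq x ++ y | x <- lin_exts B, y <- L]) [:: [::]] s.

Lemma lin_ext_uniq w : lin_ext w -> uniq w.
Proof.
rewrite uniq_pairwise; apply: sub_pairwise => x y.
by apply: contraNneq => ->; rewrite lexx.
Qed.

Lemma mem_lin_exts B w :
  (w \in lin_exts B) = [&& size w == #|B|, lin_ext w & [set x in w] == B].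
Proof.
apply/mapP/and3P => [[x]|[sz_w lin_w /eqP def_B]].
  rewrite mem_enum !inE => /andP[perm_x lin_x ->]; rewrite size_tuple; split=> //.
  by apply/eqP/setP => y; rewrite inE (perm_mem perm_x) mem_enum.
exists (Tuple sz_w) => //; rewrite mem_enum !inE lin_w andbT.
apply: uniq_perm => [||x]; [exact: lin_ext_uniq|exact: enum_uniq|].
by rewrite mem_enum -[in RHS]def_B inE.
Qed.

Lemma size_lin_exts B : size (lin_exts B) = zeta B.
Proof. by rewrite size_map -cardE. Qed.

Lemma size_arrangements s : size (arrangements s) = \prod_(B <- s) zeta B.
Proof.
elim: s => [|B s IHs] /=; first by rewrite big_nil.
by rewrite size_allpairs size_lin_exts IHs big_cons.
Qed.

Lemma arrangements_uniq s : uniq (arrangements s).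
Proof.
elim: s => //= B s IHs; apply: allpairs_uniq => //.
  by rewrite map_inj_uniq ?enum_uniq //; exact: val_inj.
move=> [x1 y1] [x2 y2] /allpairsP[[x y] /= [x_B _ [-> ->]]].
case/allpairsP=> [[x' y'] /= [x'_B _ [-> ->]]] /eqP.
move: x_B x'_B; rewrite !mem_lin_exts => /and3P[/eqP sz_x _ _] /and3P[/eqP sz_x' _ _].
by rewrite eqseq_cat ?sz_x // => /andP[/eqP-> /eqP->].
Qed.

(** The block sizes tell where to cut the word, so its factors can be recovered from the
    concatenation. *)
Lemma mem_arrangements s w :
  (w \in arrangements s) =
  [&& size w == sumn (cards s), compatible (cards s) w & blocks (cards s) w == s].
Proof.
rewrite /compatible /blocks; elim: s w => [|B s IHs] w /=.
  by rewrite inE size_eq0 andbT.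
apply/allpairsP/and3P => [[[x y] /= []]|[sz_w /andP[lin_x lin_y]]].
  rewrite mem_lin_exts IHs => /and3P[/eqP sz_x lin_x /eqP eq_x].
  move=> /and3P[/eqP sz_y lin_y /eqP eq_y] ->.
  rewrite -sz_x take_size_cat // drop_size_cat // size_cat sz_y lin_x lin_y.
  by rewrite eq_x eq_y sz_x !eqxx.
rewrite eqseq_cons => /andP[eq_x eq_y].
exists (take #|B| w, drop #|B| w); rewrite /= cat_take_drop; split=> //.
  rewrite mem_lin_exts lin_x eq_x size_takel ?eqxx //.
  by rewrite (eqP sz_w) leq_addr.
by rewrite IHs lin_y eq_y size_drop (eqP sz_w) addKn eqxx.
Qed.

Lemma cards_blocks a w : uniq w -> size w = sumn a -> cards (blocks a w) = a.
Proof.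
rewrite /cards /blocks; elim: a w => //= m a IHa w w_uniq sz_w.
rewrite IHa ?drop_uniq //; last by rewrite size_drop sz_w addKn.
congr cons; rewrite cardsE (card_uniqP _) ?take_uniq // size_takel //.
by rewrite sz_w leq_addr.
Qed.

Lemma set_composition_blocks (n : nat) a (w : n.-tuple P) :
  w \in listings n [set: P] -> composition n a -> set_composition (blocks a w).
Proof.
rewrite inE => perm_w /andP[a_gt0 /eqP sum_a].
have w_uniq : uniq w by rewrite (perm_uniq perm_w) enum_uniq.
have w_all x : x \in tval w by rewrite (perm_mem perm_w) mem_enum inE.
have flat_w : flatten (reshape a w) = w by rewrite reshapeKr // size_tuple sum_a.
have a_blocks : cards (blocks a w) = a by rewrite cards_blocks ?size_tuple.
have blocks_neq0 : set0 \notin blocks a w.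
  apply/negP => in0; have : #|@set0 P| \in a.
    by rewrite -a_blocks; apply: map_f in0.
  by move/(allP a_gt0); rewrite cards0.
have cover_blocks : cover [set B in blocks a w] = [set: P].
  apply/setP => x; rewrite inE; apply/bigcupP.
  have := w_all x; rewrite -{1}flat_w => /flattenP[b b_w x_b].
  by exists [set y in b]; rewrite inE //; apply: map_f.
(* Two equal blocks, being nonempty, would share an element, which would then occur twice in [w]. *)
have blocks_uniq : uniq (blocks a w).
  move: w_uniq blocks_neq0; rewrite -{1}flat_w /blocks.
  elim: (reshape a w) => //= b bs IHbs; rewrite cat_uniq in_cons negb_or.
  case/and3P=> _ /hasPn b_bs bs_uniq /andP[b_neq0 bs_neq0].
  rewrite IHbs // andbT; apply/mapP => -[b' b'_bs eq_b].
  rewrite eq_sym in b_neq0; case/set0Pn: b_neq0 => x x_b.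
  have : x \in flatten bs.
    by apply/flattenP; exists b' => //; rewrite eq_b inE in x_b.
  by move/b_bs; rewrite inE in x_b; rewrite x_b.
rewrite /set_composition blocks_uniq /= /partition inE blocks_neq0 andbT.
(* Disjointness comes from counting: the blocks cover [P] and their sizes add up to its
   cardinality. *)
rewrite cover_blocks eqxx /= -(geq_leqif (leq_card_cover _)) cover_blocks.
rewrite (eq_bigl (mem (blocks a w))) => [|B]; last by rewrite inE.
rewrite -big_uniq //= cardE -(perm_size perm_w) size_tuple.
have -> : \sum_(B <- blocks a w) #|B| = sumn (cards (blocks a w)).
  by rewrite /cards sumnE big_map.
by rewrite a_blocks sum_a.
Qed.

(** The blocks exhaust [P] and the word is no longer than [P] is large, so no letter repeats. *)
Lemma arrangement_listing s w : set_composition s -> w \in arrangements s ->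
  perm_eq w (enum [set: P]).
Proof.
case/andP=> s_uniq s_part; rewrite mem_arrangements.
case/and3P=> /eqP sz_w _ /eqP blocks_w.
have flat_w : flatten (reshape (cards s) w) = w by rewrite reshapeKr ?sz_w.
have w_all : {subset enum [set: P] <= w}.
  move=> x _; have : x \in cover [set B in s].
    by case/and3P: s_part => /eqP-> _ _; rewrite inE.
  case/bigcupP=> B; rewrite inE -blocks_w => /mapP[b b_w ->].
  by rewrite inE => x_b; rewrite -flat_w; apply/flattenP; exists b.
have le_w : size w <= size (enum [set: P]).
  rewrite -cardE (card_partition s_part) (eq_bigl (mem s)) => [|B]; last by rewrite inE.
  by rewrite -big_uniq //= sz_w /cards sumnE big_map.
apply: uniq_perm; rewrite ?enum_uniq //.
  exact: leq_size_uniq (enum_uniq _) w_all le_w.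
by move=> x; rewrite -(uniq_min_size (enum_uniq _) w_all le_w).2.
Qed.

(** Group the compatible listings by their sequence of segments, seen as sets: the fibre over [s]
    consists of the arrangements of [s]. *)
Lemma sum_set_compositions a : composition #|P| a ->
  \sum_(s : #|P|.-bseq {set P} | set_composition s && (cards s == a))
    \prod_(B <- s) zeta B =
  #|[set w in listings #|P| [set: P] | compatible a w]|.
Proof.
move=> a_comp; have /andP[a_gt0 /eqP sum_a] := a_comp.
(* Positive parts keep the number of blocks within the length bound of the sequences indexing
   [LP]. *)
have sz_a : size a <= #|P|.
  rewrite -sum_a -sum1_size sumnE big_seq [leqRHS]big_seq.
  by apply: leq_sum => m /(allP a_gt0).
have sz_blocks (w : seq P) : size (blocks a w) <= #|P|.
  by rewrite size_map size_reshape.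
rewrite -sum1_card.
rewrite (partition_big (fun x : #|P|.-tuple P => Bseq (sz_blocks x))
           (fun s : #|P|.-bseq {set P} => set_composition s && (cards s == a))); last first.
  move=> w; rewrite inE => /andP[w_list _] /=.
  rewrite set_composition_blocks // cards_blocks ?eqxx //.
    by rewrite inE in w_list; rewrite (perm_uniq w_list) enum_uniq.
  by rewrite size_tuple.
apply: eq_bigr => s /andP[s_comp /eqP card_s].
rewrite sum1_card -size_arrangements cardE -(size_map val).
apply/perm_size/uniq_perm => [||w].
- exact: arrangements_uniq.
- by rewrite map_inj_uniq ?enum_uniq //; exact: val_inj.
apply/idP/mapP => [w_s|[x]].
  have perm_w := arrangement_listing s_comp w_s.
  move: w_s; rewrite mem_arrangements card_s sum_a => /and3P[sz_w w_comp blocks_w].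
  exists (Tuple sz_w) => //; rewrite mem_enum unfold_in !inE perm_w w_comp /=.
  exact: blocks_w.
rewrite mem_enum unfold_in !inE => /andP[/andP[_ w_comp] /eqP blocks_w] ->.
rewrite mem_arrangements card_s sum_a size_tuple w_comp eqxx.
by rewrite -blocks_w /= eqxx.
Qed.

End Arrangements.

Local Open Scope ring_scope.

(** * Coefficients of monomials in $F$, $M$ and $L_P$ *)

Lemma fsbig_indicator (R : pzSemiRingType) (T : choiceType) (A : set T) (b : pred T) (x : T) :
    (forall y, A y -> b y -> y = x) ->
  \sum_(y \in A) ((b y)%:R : R) = `[< A x /\ b x >]%:R.
Proof.
move=> uniq_x; case: asboolP => [[Ax bx]|notx]; last first.
  rewrite fsbig1 // => y Ay; case b_y: (b y) => //.
  by case: notx; rewrite -(uniq_x y).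
rewrite -(fsbig_widen [set x]%classic A); first by rewrite fsbig_set1 bx.
  by move=> _ ->.
move=> y [Ay /= ne_yx]; case b_y: (b y) => //.
by case: ne_yx; apply: uniq_x.
Qed.

Lemma spread_tuple n (i : n.-tuple nat) : spread i (nseq n 1%N) = i.
Proof. by rewrite -[RHS]spread1 size_tuple. Qed.

(** Only [letters u] can contribute, being the one weakly increasing word with content [u]; it does
    so when it has length [n] and is strict at every element of [I]. *)
Lemma QFE (K : fieldType) n (I : {set 'I_n.-1}) u :
  QF K I u = ((size (letters u) == n) && (I \subset ascents n (letters u)))%:R.
Proof.
rewrite /QF; have [sz_u|ne_sz] /= := eqVneq; last first.
  rewrite fsbig1 // => i _; rewrite xmon_eqE spread_tuple.
  case: (boolP (perm_eq _ _)) => // /perm_size sz_i.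
  by rewrite -sz_i size_tuple eqxx in ne_sz.
have sz_u' : size (letters u) == n by apply/eqP.
rewrite (@fsbig_indicator _ _ _ _ (Tuple sz_u')) => [|i [i_sorted _]]; last first.
  rewrite xmon_eqE spread_tuple => eq_i; apply: val_inj => /=.
  exact: (sorted_eq leq_trans anti_leq) i_sorted (letters_sorted u) eq_i.
congr (nat_of_bool _)%:R; apply/asboolP/subsetP => /= [[[_ asc] _] j j_I|asc].
  by rewrite inE asc.
split; last by rewrite xmon_eqE (spread_tuple (Tuple sz_u')).
by split=> [|j /asc]; rewrite ?letters_sorted ?inE.
Qed.

(** The monomial [u] forces [i] to be its distinct letters and [a] their multiplicities; a zero
    exponent would leave an entry of [i] undetermined. *)
Lemma QME (K : fieldType) a u : all (leq 1%N) a ->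
  QM K a u = (a == runs (letters u))%:R.
Proof.
move=> a_gt0; rewrite /QM.
have run_a (i : (size a).-tuple nat) : sorted ltn i -> xmon i a == u ->
    i = undup (letters u) :> seq nat /\ a = runs (letters u).
  rewrite xmon_eqE => i_sorted eq_i.
  have <- : spread i a = letters u.
    apply: (sorted_eq leq_trans anti_leq) => //; last exact: letters_sorted.
    exact: spread_sorted.
  by rewrite undup_spread ?runs_spread ?size_tuple.
have [def_a|ne_a] := eqVneq; last first.
  rewrite fsbig1 // => i /= i_sorted; case: eqP => // /eqP /(run_a i i_sorted)[_].
  by move/eqP; rewrite (negbTE ne_a).
have sz_i : size (undup (letters u)) == size a by rewrite def_a size_map.
rewrite (@fsbig_indicator _ _ _ _ (Tuple sz_i)) => [|i i_sorted eq_i]; last first.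
  by apply: val_inj; case: (run_a i).
rewrite asboolT //=; split.
  rewrite ltn_sorted_uniq_leq undup_uniq /=.
  exact: (subseq_sorted leq_trans (undup_subseq _)) (letters_sorted u).
by rewrite xmon_eqE def_a spread_runs ?letters_sorted.
Qed.

(** By [QME] only set compositions whose block sizes are the run lengths of [u] survive, and
    [sum_set_compositions] counts their contribution. *)
Lemma LPE (K : fieldType) (d : Order.disp_t) (P : finPOrderType d) u :
  LP K P u = if size (letters u) == #|P| then
    #|[set w in listings #|P| [set: P] | compatible (runs (letters u)) w]|%:R
  else 0.
Proof.
rewrite /LP; set a := runs _.
have sum_s (s : seq {set P}) : set_composition s -> composition #|P| (cards s).
  move=> s_comp; have /andP[s_uniq s_part] := s_comp.
  apply/andP; split.
    apply/allP => _ /mapP[B B_s ->]; rewrite card_gt0.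
    by case/and3P: s_part => _ _; apply: contraNneq => <-; rewrite inE.
  rewrite /cards sumnE big_map big_uniq //= -cardsT (card_partition s_part).
  by apply/eqP/eq_bigl => B; rewrite inE.
under eq_bigr => s s_comp.
  rewrite QME; last by case/andP: (sum_s s s_comp).
  over.
have a_comp := runs_composition (letters u); rewrite -/a in a_comp.
case: eqP => [sz_u|ne_sz]; last first.
  rewrite big1 // => s /sum_s /andP[_ sum_s'].
  case: eqP => [eq_s|_]; last by rewrite mulr0.
  case: ne_sz; have /andP[_ /eqP <-] := a_comp.
  by rewrite -[a]eq_s; exact/eqP.
rewrite sz_u in a_comp.
rewrite -sum_set_compositions // natr_sum [RHS]big_mkcondr /=.
apply: eq_bigr => s _.
by rewrite /cards; case: eqP => _; rewrite ?mulr1 ?mulr0.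
Qed.

(** * Möbius inversion for an up-set *)

Section ChiSum.
Context {T : finType}.
Implicit Types (A : {set {set T}}) (U S D : {set T}).

Lemma sum_sign_interval U D : U \subset D ->
  \sum_(S : {set T} | (U \subset S) && (S \subset D)) (-1) ^+ (#|S| - #|U|) =
    (U == D)%:R :> int.
Proof.
move=> sUD; have [<-|neUD] := eqVneq U D.
  rewrite (big_pred1 U) ?subnn // => S.
  by rewrite andbC -eqEsubset.
have /properP[_ [x x_D x_U]] : U \proper D by rewrite properEneq neUD.
(* Adding x to S is a sign-reversing pairing of the interval. *)
rewrite (bigID (fun S : {set T} => x \in S)) /=.
rewrite (reindex_onto (fun S => x |: S) (fun S => S :\ x)) /=; last first.
  by move=> S /andP[_ x_S]; rewrite setD1K.
rewrite (eq_bigl (fun S => [&& U \subset S, S \subset D & x \notin S])) => [|S].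
  rewrite (eq_bigr (fun S : {set T} => - (-1) ^+ (#|S| - #|U|))) => [|S].
    rewrite sumrN [X in _ + X](eq_bigl (fun S => [&& U \subset S, S \subset D & x \notin S])).
      by rewrite addNr.
    by move=> S; rewrite andbA.
  case/and3P=> /subset_leq_card le_US _ x_S.
  by rewrite cardsU1 x_S add1n subSn // exprS mulN1r.
rewrite setU11 andbT subUset sub1set x_D /=.
have [x_S|x_S] := boolP (x \in S).
  rewrite /= !andbF; apply/negbTE/negP => /andP[_ /eqP eq_S].
  by rewrite -eq_S setD11 in x_S.
rewrite setU1K // eqxx !andbT; congr (_ && _).
by rewrite -(setU1K x_S) subsetD1 x_U andbT setU1K.
Qed.

(** After exchanging the sums, a fixed [U] in [A] meets every [S] of the Boolean interval from [U]
    to [D], since all of them lie in [A]. The alternating sum over that interval vanishes unless [U]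
    is [D]. *)
Lemma sum_chi_upset A D :
    (forall X Y : {set T}, X \in A -> X \subset Y -> Y \in A) ->
  \sum_(S in A | S \subset D) chi A S = (D \in A)%:R.
Proof.
move=> A_up; rewrite /chi.
rewrite (exchange_big_dep (fun U => (U \in A) && (U \subset D))) /=; last first.
  move=> S U /andP[S_A sSD] /andP[-> sUS]; exact: subset_trans sSD.
rewrite (eq_bigr (fun U => (U == D)%:R)) => [|U /andP[U_A sUD]]; last first.
  rewrite -(sum_sign_interval sUD); apply: eq_big => S.
    rewrite U_A /= andbC; have [sUS|//] := boolP (U \subset S).
    by rewrite (A_up _ _ U_A sUS).
  by case/andP=> _ /andP[_ sUS]; rewrite chain_length_upset.
have [D_A|D_A] := boolP (D \in A); last first.
  by rewrite big1 // => U /andP[U_A _]; case: eqP D_A => // <-; rewrite U_A.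
rewrite (bigD1 D) ?D_A ?subxx //= eqxx big1 // => U /andP[_ neUD].
by rewrite (negPf neUD).
Qed.

End ChiSum.

(** * Expansions in the $F$ basis and their uniqueness *)

Section Expansion.
Context {K : fieldType}.
Implicit Types (f : pseries K) (c : Fcoefs K).

Local Notation index m J := (Tagged (fun l => {set 'I_l.-1}) (i := m) J).

Lemma F_expansion_coef c u (m := size (letters u)) :
  \sum_(b <- finsupp c) c b * QF K (tagged b) u =
  \sum_(J : {set 'I_m.-1} | J \subset ascents m (letters u)) c (index m J).
Proof.
pose p (b : {m : nat & {set 'I_m.-1}}) :=
  (m == tag b) && (tagged b \subset ascents (tag b) (letters u)).
rewrite (eq_bigr (fun b => if p b then c b else 0)) => [|b _]; last first.
  by rewrite QFE -/m -/(p b); case: (p b); rewrite ?mulr1 ?mulr0.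
rewrite -big_mkcond -big_filter.
pose s := [seq index m J | J <- enum [set J : {set _} | J \subset ascents m (letters u)]].
(* Both lists enumerate the supported indices of degree [m] with set inside the ascents; unsupported
   ones have coefficient zero and can be added afterwards. *)
rewrite (perm_big [seq b <- s | b \in finsupp c]); last first.
  apply: uniq_perm => [||b].
  - by rewrite filter_uniq // fset_uniq.
  - rewrite filter_uniq // map_inj_uniq ?enum_uniq // => J J' /eqP.
    by rewrite eq_Tagged /= => /eqP.
  rewrite !mem_filter andbC; congr (_ && _).
  apply/andP/mapP => [[/eqP]|[J]].
    case: b => k J /= eq_mk sJ; case: k / eq_mk J sJ => J sJ; exists J => //.
    by rewrite mem_enum inE.
  by rewrite mem_enum inE => sJ ->.
rewrite big_filter big_map big_enum_cond /= big_mkcond [RHS]big_mkcond.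
apply: eq_bigr => J _; rewrite inE.
by case: (J \subset _) => //=; case: ifPn => // /fsfun_dflt.
Qed.

Lemma F_expansionE f c : F_expansion f c <->
  forall u, f u = \sum_(J : {set 'I_(size (letters u)).-1} |
      J \subset ascents (size (letters u)) (letters u)) c (index (size (letters u)) J).
Proof. by split=> f_c u; rewrite f_c F_expansion_coef. Qed.

(** Every [D] is the ascent set of some monomial, so the sums of [c] and [c'] over the subsets of
    [D] agree; induction on the cardinality then isolates the term of [J] itself. *)
Lemma F_expansion_uniq f c c' : F_expansion f c -> F_expansion f c' -> c = c'.
Proof.
move=> /F_expansionE f_c /F_expansionE f_c'; apply/fsfunP => -[m J].
have sum_c (D : {set 'I_m.-1}) : \sum_(J' : {set 'I_m.-1} | J' \subset D) c (index m J') =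
    \sum_(J' : {set 'I_m.-1} | J' \subset D) c' (index m J').
  have [u sz_u asc_u] := exists_ascents D.
  by have := f_c u; rewrite f_c'; move: asc_u; rewrite sz_u => ->.
have [k le_k] := ubnP #|J|; elim: k J le_k => // k IHk J le_k.
have := sum_c J; rewrite (bigD1 J) //= [RHS](bigD1 J) //=.
rewrite [X in _ + X = _](eq_bigr (fun J' => c' (index m J'))) => [|J'].
  by move/addIr.
rewrite andbC -properEneq => /proper_card lt_J'; apply: IHk.
exact: leq_trans lt_J' _.
Qed.

End Expansion.

(** * Summation over listings and conclusion *)

(** With the listing outermost, the inner sum is that of [sum_chi_upset] for [Comp w]. *)
Lemma sum_chi_Comp (d : Order.disp_t) (P : finPOrderType d) n (D : {set 'I_n.-1}) :
  \sum_(J : {set 'I_n.-1} | J \subset D) \sum_(w in Sigma (P := P) J) chi (Comp w) J =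
  #|[set w in listings n [set: P] | D \in Comp w]|%:R.
Proof.
rewrite (exchange_big_dep (mem (listings n [set: P]))) /=; last first.
  by move=> J w _; rewrite [w \in Sigma J]inE => /andP[].
rewrite -sum1_card natr_sum big_mkcond [RHS]big_mkcond /=.
apply: eq_bigr => w _; rewrite [in RHS]inE; case: ifPn => //= w_list.
rewrite (eq_bigl (fun J => (J \in Comp w) && (J \subset D))) => [|J].
  rewrite sum_chi_upset; first by case: (D \in _).
  by move=> X Y; exact: Comp_upset.
by rewrite [w \in _]inE w_list andbC.
Qed.

Theorem theorem4p10 (K : fieldType) (hK : [pchar K] =i pred0)
    (d : Order.disp_t) (P : finPOrderType d) (n : nat) (hn : #|P| = n)
    (I : {set 'I_n.-1}) :
  (exists! c : Fcoefs K, F_expansion (LP K P) c) /\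
  (forall c : Fcoefs K, F_expansion (LP K P) c ->
    c (Tagged (fun m => {set 'I_m.-1}) I) =
      (\sum_(w in Sigma (P := P) I) chi (Comp w) I)%:~R).
Proof.
pose g m (J : {set 'I_m.-1}) : K :=
  (\sum_(w in Sigma (P := P) J) chi (Comp w) J)%:~R.
pose S := [fset Tagged (fun m => {set 'I_m.-1}) J | J in {: {set 'I_n.-1}}]%fset.
pose c : Fcoefs K := [fsfun b in S => g (tag b) (tagged b) | 0].
(* In degrees other than [n] there are no listings, so [g] vanishes there and agrees with the
   default value of [c]. *)
have listings0 m : m != n -> listings m [set: P] = set0.
  move=> ne_mn; apply/setP => w; rewrite !inE; apply: contraNF ne_mn => /perm_size.
  by rewrite size_tuple -cardE cardsT hn => ->.
have cE m (J : {set 'I_m.-1}) : c (Tagged (fun m => {set 'I_m.-1}) J) = g m J.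
  rewrite fsfunE; case: ifPn => //= J_S; rewrite /g big1 // => w.
  rewrite inE => /andP[w_list _]; case/negP: J_S.
  have [/esym eq_mn|/listings0 list0] := eqVneq m n; last by rewrite list0 inE in w_list.
  by case: m / eq_mn J w w_list => J _ _; apply/imfsetP; exists J.
have c_LP : F_expansion (LP K P) c.
  apply/F_expansionE => u; rewrite LPE hn.
  (* The sum becomes the number of listings [w] with the ascent set of [letters u] in [Comp w], to
     be matched with the count in [LPE]. *)
  rewrite (eq_bigr _ (fun J _ => cE _ J)) /g -rmorph_sum sum_chi_Comp.
  rewrite rmorph_nat.
  case: eqP => [sz_u|/eqP/listings0 list0]; last first.
    by rewrite eq_card0 // => w; rewrite inE list0 inE.
  rewrite sz_u; congr (_%:R); apply: eq_card => w; rewrite !inE; congr (_ && _).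
  have := runs_composition (letters u); rewrite sz_u => /mem_Comp_comp_set <-.
  by rewrite comp_set_runs ?letters_sorted // inE.
split=> [|c' c'_LP]; last by rewrite (F_expansion_uniq c'_LP c_LP) cE.
by exists c; split=> // c' c'_LP; exact: F_expansion_uniq c_LP c'_LP.
Qed.
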